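(* Assume that the graph $G$ is a tree, that the hypergraph $\mathcal H$ with node set $C$ and edges $C_1,\dots,C_\ell$ is connected, and that the clusters are edge-disjoint, i.e. $\mathcal P_{C_r}\cap\mathcal P_{C_{r'}}=\emptyset$ for all $r\neq r'$. Let the clusters be selected with probabilities $\rho_1,\dots,\rho_\ell>0$, $\sum_r\rho_r=1$, let $F_{\mathrm{ave}}=\sum_{r=1}^\ell\rho_rF_r$ and $E_{\mathrm{ave}}=\sum_{r=1}^\ell\rho_rE_r$, and let $\beta=\max\{|\lambda|:\lambda\text{ eigenvalue of }F_{\mathrm{ave}},\ \lambda\ne1\}$. Then: (a) every vector in the column space of $\Omega_r$ is an eigenvector of $E_{\mathrm{ave}}$ associated with the eigenvalue $\rho_r$; besides the zero eigenvalue, the eigenvalues of $E_{\mathrm{ave}}$ are exactly $\rho_1,\dots,\rho_\ell$, and so $\beta=1-\min_{r=1,\dots,\ell}\rho_r$; (b) $\beta$ is minimized by taking $\rho_r=1/\ell$ for all $r$, obtaining $\beta=1-\frac1\ell$; (c) $m-1=\sum_{r=1}^\ell|C_r|-\ell$; if all the sets $C_r$ have the same cardinality $c$, then $\ell c=m+\ell-1$, and so (with $\rho_r=1/\ell$ for all $r$) $\beta=1-\frac1\ell=1-\frac{c-1}{m-1}$. This hypergraph is optimal, in the sense that it attains the lower bound $\beta\ge1-\frac{c-1}{m-1}$ valid for every connected hypergraph on $C$ whose edges all have cardinality $c$ and all strictly positive selection probabilities.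
   Context: Let $G$ be a finite directed graph with node set $V$, $|V|=n$, a distinguished node $0$, and edge set $E$ (each edge $e$ going from $\sigma(e)$ to $\tau(e)$), connected irrespective of edge orientation (''tree'' and ''path'' also disregard orientation). $A\in\{0,\pm1\}^{|E|\times n}$ is the incidence matrix: $[A]_{ev}=-1$ if $v=\sigma(e)$, $1$ if $v=\tau(e)$, $0$ otherwise. $z_e\in\mathbb{C}$ is the impedance of the power line represented by edge $e$; $Z=\mathrm{diag}(z_e)$, $L=A^TZ^{-1}A$, and $X\in\mathbb{C}^{n\times n}$ is the unique symmetric matrix with $XL=I-\mathbf{1}\mathbf{1}_0^T$, $X\mathbf{1}_0=0$ (with $\mathbf{1}$ the all-ones vector, $\mathbf{1}_0$ the basis vector of node $0$). $C\subset V$ is the set of compensators, $m=|C|$, and $M\in\mathbb{R}^{m\times m}$ is the principal submatrix of $\mathrm{Re}(X)$ indexed by $C$. The clusters $C_1,\dots,C_\ell$ are possibly overlapping subsets of $C$ with $\bigcup_rC_r=C$. Vectors in $\mathbb{R}^m$ are indexed by $C$; $\mathbf{1}_{C_r}$ is the indicator vector of $C_r$, and $$\Omega_r:=\mathrm{diag}(\mathbf{1}_{C_r})-\frac{1}{|C_r|}\mathbf{1}_{C_r}\mathbf{1}_{C_r}^T,\qquad E_r:=(\Omega_rM\Omega_r)^\sharp M,\qquad F_r:=I-E_r,$$ with $\sharp$ the pseudoinverse. For nodes $h,k$, $\mathcal P_{hk}\subseteq E$ is the (edge set of the) shortest path connecting $h$ and $k$ in $G$, and $\mathcal P_{C_r}:=\bigcup_{h,k\in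 C_r}\mathcal P_{hk}$. A hypergraph is a pair (nodes, edges) in which each edge is a subset of the nodes, of arbitrary cardinality; it is connected if any two nodes are joined by a chain of hyperedges in which consecutive hyperedges intersect.
   Formalization: Two assumptions are added: every line impedance z_e has positive real part (if all z_e are purely imaginary, M = 0 and the claim fails), and every cluster C_r has at least two elements (for a singleton, Ω_r = 0 and ρ_r need not be an eigenvalue). *)

(* Defs.v *)
From mathcomp Require Import all_boot all_order all_algebra.
From mathcomp Require Export complex.

Set Implicit Arguments.
Unset Strict Implicit.
Unset Printing Implicit Defensive.

Import Order.TTheory GRing.Theory Num.Theory.
Local Open Scope ring_scope.
Local Open Scope complex_scope.

(* A directed multigraph with nodes 'I_n and edges 'I_p is given by its source
   and target maps.  Walks, connectedness, cycles and shortest paths disregard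
   the orientation of the edges. *)
Section Graph.
Variables (n p : nat) (src tgt : 'I_p -> 'I_n).

Definition joins (e : 'I_p) (h k : 'I_n) : bool :=
  (src e == h) && (tgt e == k) || (src e == k) && (tgt e == h).

(* A walk is recorded by the list of the edges it traverses. *)
Fixpoint walk (s : seq 'I_p) (h k : 'I_n) : bool :=
  if s is e :: s' then [exists u, joins e h u && walk s' u k] else h == k.

Definition graph_connected : Prop := forall h k, exists s, walk s h k.

(* A closed walk with pairwise distinct edges contains a cycle; loops and pairs
   of parallel edges are cycles. *)
Definition acyclic : Prop :=
  forall h s, walk s h h -> uniq s -> s = [::].

Definition is_tree : Prop := graph_connected /\ acyclic.

Definition shortest_path (s : seq 'I_p) (h k : 'I_n) : Prop :=
  walk s h k /\ forall s', walk s' h k -> (size s <= size s')%N.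

(* Membership in P_hk.  In a tree the shortest path is unique. *)
Definition in_path (h k : 'I_n) (e : 'I_p) : Prop :=
  exists2 s, shortest_path s h k & e \in s.

(* Membership in P_S, the union of the P_hk for h, k in S. *)
Definition in_span_paths (S : {set 'I_n}) (e : 'I_p) : Prop :=
  exists h k, [/\ h \in S, k \in S & in_path h k e].

Definition edge_disjoint (l : nat) (Cl : 'I_l -> {set 'I_n}) : Prop :=
  forall r r', r != r' ->
  forall e, ~ (in_span_paths (Cl r) e /\ in_span_paths (Cl r') e).

End Graph.

Section Hypergraph.
Variables (n l : nat) (C : {set 'I_n}) (Cl : 'I_l -> {set 'I_n}).

Definition clustering : Prop :=
  (forall r, Cl r \subset C) /\ \bigcup_r Cl r = C.

Definition hyper_connected : Prop :=
  forall h k, h \in C -> k \in C ->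
  exists r s, [/\ h \in Cl r, k \in Cl s &
    connect (fun t u => Cl t :&: Cl u != set0) r s].

End Hypergraph.

Section PseudoInverse.
Variable R : realFieldType.

(* The four Penrose equations. *)
Definition is_pinv m n (A : 'M[R]_(m, n)) (B : 'M[R]_(n, m)) : bool :=
  [&& A *m B *m A == A, B *m A *m B == B,
      (A *m B)^T == A *m B & (B *m A)^T == B *m A].

Lemma gram_unit m n (A : 'M[R]_(m, n)) :
  row_free A -> A *m A^T \in unitmx.
Proof.
move=> fA; rewrite -row_free_unit -kermx_eq0; apply/eqP/row_matrixP => i.
rewrite row0; set v := row i _.
have vAA : v *m A *m (v *m A)^T = 0.
  rewrite trmx_mul mulmxA -(mulmxA v).
  by rewrite (sub_kermxP (row_sub i _)) mul0mx.
have vA0 : v *m A = 0.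
  apply/rowP => j; rewrite mxE.
  have /matrixP/(_ 0 0) := vAA; rewrite !mxE.
  under eq_bigr => k _ do rewrite [(v *m A)^T _ _]mxE -expr2.
  move/eqP; rewrite psumr_eq0; last by move=> k _; apply: sqr_ge0.
  by move/allP/(_ j); rewrite mem_index_enum sqrf_eq0 mxE => /(_ isT)/eqP ->.
by apply: (row_free_inj fA); rewrite vA0 mul0mx.
Qed.

Lemma pinv_exists m n (A : 'M[R]_(m, n)) : exists B, is_pinv A B.
Proof.
set P := col_base A; set Q := row_base A.
have uQ : Q *m Q^T \in unitmx by apply/gram_unit/row_base_free.
have uP : P^T *m P \in unitmx.
  rewrite -[X in _ *m X]trmxK; apply: gram_unit.
  by rewrite /row_free mxrank_tr; apply: col_base_full.
pose S := invmx (Q *m Q^T); pose T := invmx (P^T *m P).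
have S_sym : S^T = S by rewrite /S trmx_inv trmx_mul trmxK.
have T_sym : T^T = T by rewrite /T trmx_inv trmx_mul trmxK.
have QS : Q *m (Q^T *m S) = 1%:M by rewrite mulmxA mulmxV.
have TP : T *m P^T *m P = 1%:M by rewrite -mulmxA mulVmx.
pose B := Q^T *m S *m (T *m P^T).
have eqA : P *m Q = A by apply: mulmx_base.
have AB : A *m B = P *m (T *m P^T).
  by rewrite -[X in X *m _ = _]eqA /B -(mulmxA P) (mulmxA Q) QS mul1mx.
have BA : B *m A = Q^T *m S *m Q.
  by rewrite -[X in _ *m X = _]eqA /B -(mulmxA (Q^T *m S)) (mulmxA (T *m P^T)) TP mul1mx.
exists B; apply/and4P; split; apply/eqP.
- by rewrite AB -[X in _ *m X = _]eqA -(mulmxA P) (mulmxA (T *m P^T)) TP mul1mx.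
- by rewrite BA /B -(mulmxA (Q^T *m S)) (mulmxA Q) QS mul1mx.
- by rewrite AB 2!trmx_mul trmxK T_sym mulmxA.
- by rewrite BA (trmx_mul _ Q) (trmx_mul Q^T) trmxK S_sym mulmxA.
Qed.

Lemma pinv_unique m n (A : 'M[R]_(m, n)) B B' :
  is_pinv A B -> is_pinv A B' -> B = B'.
Proof.
case/and4P=> /eqP a1 /eqP b1 /eqP c1 /eqP d1.
case/and4P=> /eqP a2 /eqP b2 /eqP c2 /eqP d2.
have e1 : A *m B = A *m B'.
  by rewrite -c1 -[in LHS]a2 -(mulmxA (A *m B')) trmx_mul c1 c2 mulmxA a1.
have e2 : B *m A = B' *m A.
  by rewrite -d1 -[in LHS]a2 -(mulmxA A) mulmxA trmx_mul d1 d2 -mulmxA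
             (mulmxA A) a1.
by rewrite -b1 e2 -mulmxA e1 mulmxA b2.
Qed.

(* The Moore-Penrose pseudoinverse; [pinvmx] of mxalgebra need not satisfy the
   two symmetry equations. *)
Definition pinv m n (A : 'M[R]_(m, n)) : 'M[R]_(n, m) :=
  xchoose (pinv_exists A).

End PseudoInverse.

Section Network.
Variables (R : rcfType) (n p : nat) (src tgt : 'I_p -> 'I_n).

Definition incidence : 'M[R[i]]_(p, n) :=
  \matrix_(e, v) (if v == src e then -1 else if v == tgt e then 1 else 0).

Definition laplacian (z : 'I_p -> R[i]) : 'M[R[i]]_n :=
  incidence^T *m invmx (diag_mx (\row_e z e)) *m incidence.

(* The equations that characterize X; the node o is the distinguished node. *)
Definition is_green (z : 'I_p -> R[i]) (o : 'I_n) (X : 'M[R[i]]_n) : Prop :=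
  [/\ X^T = X,
      X *m laplacian z =
        1%:M - (const_mx 1 : 'cV_n) *m (delta_mx o 0 : 'cV_n)^T
    & X *m (delta_mx o 0 : 'cV_n) = 0].

End Network.

(* The elements of C index R^m, m = #|C|, through enum_val. *)
Section Clusters.
Variables (R : rcfType) (n : nat) (C : {set 'I_n}).

Definition re_submx (X : 'M[R[i]]_n) : 'M[R]_#|C| :=
  \matrix_(i, j) complex.Re (X (enum_val i) (enum_val j)).

Definition indic (S : {set 'I_n}) : 'cV[R]_#|C| :=
  \col_i (enum_val i \in S)%:R.

Definition Omega (S : {set 'I_n}) : 'M[R]_#|C| :=
  diag_mx (indic S)^T - (#|S|%:R)^-1 *: (indic S *m (indic S)^T).

Variable M : 'M[R]_#|C|.

Definition Ecl (S : {set 'I_n}) : 'M[R]_#|C| :=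
  pinv (Omega S *m M *m Omega S) *m M.

Definition Fcl (S : {set 'I_n}) : 'M[R]_#|C| := 1%:M - Ecl S.

Variables (l : nat) (Cl : 'I_l -> {set 'I_n}) (rho : 'I_l -> R).

Definition Eave : 'M[R]_#|C| := \sum_(r < l) rho r *: Ecl (Cl r).
Definition Fave : 'M[R]_#|C| := \sum_(r < l) rho r *: Fcl (Cl r).

End Clusters.

Section Spectrum.
Variable R : rcfType.

(* lambda is a (complex) eigenvalue of the real matrix A. *)
Definition ceigenvalue m (A : 'M[R]_m) (lambda : R[i]) : bool :=
  eigenvalue (map_mx (real_complex R) A) lambda.

(* b is the maximum of |lambda| over the eigenvalues lambda != 1 of F. *)
Definition is_beta m (F : 'M[R]_m) (b : R) : Prop :=
  (exists lambda, [/\ ceigenvalue F lambda, lambda != 1 & `|lambda| = b%:C]) /\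
  (forall lambda, ceigenvalue F lambda -> lambda != 1 -> `|lambda| <= b%:C).

Definition pos_prob l (rho : 'I_l -> R) : Prop :=
  (forall r, 0 < rho r) /\ \sum_(r < l) rho r = 1.

Definition uniform_prob (l : nat) : 'I_l -> R := fun _ => l%:R^-1.

(* The neutral element 1 is harmless: it bounds every probability. *)
Definition min_prob l (rho : 'I_l -> R) : R := \big[Num.min/1]_(r < l) rho r.

End Spectrum.

(* Main.v *)
Require Import Defs.
From mathcomp Require Import all_boot all_order all_algebra complex.

Set Implicit Arguments.
Unset Strict Implicit.
Unset Printing Implicit Defensive.

Import Order.TTheory GRing.Theory Num.Theory.
Local Open Scope ring_scope.
Local Open Scope complex_scope.

(* In a tree, removing the edge e leaves two components; let B be the matrix
   whose columns indicate the component of the target of e.  The incidence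
   matrix A satisfies A B = 1, and the equations of X give
   x^T X y = x^T B Z B^T y whenever x and y have zero sum.  Taking real parts,
   M is positive definite on the vectors of zero sum, and Omega_r M Omega_s = 0
   for edge-disjoint clusters, because an edge that separates two nodes of C_r
   lies on a path of C_r.

   Positive definiteness makes E_r an M-orthogonal projection onto the image of
   Omega_r, so that tr E_r = |C_r| - 1; connectedness of the hypergraph makes
   E_ave injective on the vectors of zero sum, a space of dimension m - 1.  In
   the edge-disjoint case E_r Omega_s = 0 for r <> s gives the spectrum, and
   \sum_r E_r is the identity on the vectors of zero sum; its trace is m - 1.
   In general, the m - 1 eigenvalues of E_ave on the vectors of zero sum are
   nonzero and add up to c - 1, so one of them has real part at most
   (c - 1) / (m - 1). *)

(** * Walks and fundamental cuts *)

Section Walks.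
Variables (n p : nat) (src tgt : 'I_p -> 'I_n).
Implicit Types (e : 'I_p) (h k u v : 'I_n) (s : seq 'I_p).
Local Notation walk := (walk src tgt).
Local Notation joins := (joins src tgt).

Lemma joinsC e h k : joins e h k = joins e k h.
Proof. by rewrite /Defs.joins orbC. Qed.

Lemma walk_consP e s h k :
  reflect (exists2 u, joins e h u & walk s u k) (walk (e :: s) h k).
Proof.
by apply: (iffP existsP) => [[u /andP[]]|[u ehu wuk]]; exists u; rewrite ?ehu.
Qed.

Lemma walk_catP s1 s2 h k :
  reflect (exists2 u, walk s1 h u & walk s2 u k) (walk (s1 ++ s2) h k).
Proof.
apply: (iffP idP).
  elim: s1 h => [|e s1 IHs] h; first by move=> w; exists h => /=.
  move=> /walk_consP[u ehu /IHs[v s1uv s2vk]].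
  by exists v => //; apply/walk_consP; exists u.
case=> u; elim: s1 h => [|e s1 IHs] h; first by move=> /eqP ->.
move=> /walk_consP[v ehv s1vu] s2uk.
by apply/walk_consP; exists v => //; apply: IHs.
Qed.

Lemma joins_inv e h k u v :
  joins e h k -> joins e u v -> h = u \/ h = v.
Proof.
by case/orP=> /andP[/eqP he /eqP ke] /orP[] /andP[/eqP ue /eqP ve]; subst; auto.
Qed.

(** Induction on the walk: if the first edge recurs in the shortened remainder, h is an end of that
    occurrence, and the walk resumes there, with or without that edge. *)
Lemma uniq_subwalk s h k : walk s h k ->
  exists s', [/\ walk s' h k, uniq s' & {subset s' <= s}].
Proof.
elim: s h => [|e s IHs] h; first by exists [::].
case/walk_consP=> u ehu /IHs[s' [s'uk Us' sub]].
have sub' : {subset s' <= e :: s} by move=> x /sub xs; rewrite inE xs orbT.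
case: (boolP (e \in s')) => [es'|nes']; last first.
  exists (e :: s'); split; first by apply/walk_consP; exists u.
    by rewrite /= nes'.
  by move=> x; rewrite inE => /predU1P[-> |/sub']; rewrite ?mem_head.
case/splitPr: es' s'uk Us' sub' => s1 s2 /walk_catP[a _].
case/walk_consP=> b eab s2bk; rewrite cat_uniq => /and3P[_ _ U2] sub'.
have [ha|hb] := joins_inv ehu eab.
  exists (e :: s2); split=> //; first by apply/walk_consP; exists b => //; rewrite ha.
  by move=> x xs; apply: sub'; rewrite mem_cat xs orbT.
exists s2; split; [by rewrite hb | by case/andP: U2 |].
by move=> x xs; apply: sub'; rewrite mem_cat inE xs !orbT.
Qed.

Definition avoid e : rel 'I_n := fun u v => [exists f, (f != e) && joins f u v].

(* For a tree, the component of the target of e after the removal of e. *)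
Definition side e : {set 'I_n} := [set v | connect (avoid e) (tgt e) v].

Lemma connect_avoid_walk e u v :
  connect (avoid e) u v -> exists2 s, walk s u v & e \notin s.
Proof.
case/connectP=> q; elim: q u => [|w q IHq] u /=; first by move=> _ ->; exists [::] => /=.
case/andP=> /existsP[f /andP[fe fuw]] /IHq{}IHq /IHq[s swv es].
exists (f :: s); first by apply/walk_consP; exists w.
by rewrite inE negb_or eq_sym fe.
Qed.

Lemma mem_side_tgt e : tgt e \in side e.
Proof. by rewrite inE connect0. Qed.

Lemma side_joins e f u v : f != e -> joins f u v -> (u \in side e) = (v \in side e).
Proof.
move=> fe fuv; rewrite !inE.
by apply/idP/idP => /connect_trans; apply; apply: connect1; apply/existsP; exists f;
  rewrite fe // joinsC.
Qed.

Lemma side_edge e f : f != e -> (src f \in side e) = (tgt f \in side e).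
Proof. by move=> /side_joins; apply; rewrite /Defs.joins !eqxx. Qed.

(** A walk from the target of e back to its source avoiding e, once its edges are made distinct,
    would close up with e into a cycle. *)
Lemma acyclic_src_side e : acyclic src tgt -> src e \notin side e.
Proof.
move=> acyc; apply/negP; rewrite inE => /connect_avoid_walk[s].
case/uniq_subwalk=> s' [ws' Us' sub] es.
have /acyc : walk (e :: s') (src e) (src e).
  by apply/walk_consP; exists (tgt e) => //; rewrite /Defs.joins !eqxx.
suff -> : uniq (e :: s') by move/(_ isT).
by rewrite /= Us' andbT; apply: contra es => /sub.
Qed.

Lemma acyclic_src_tgt e : acyclic src tgt -> src e != tgt e.
Proof.
by move=> /(acyclic_src_side e); apply: contra => /eqP->; apply: mem_side_tgt.
Qed.

Lemma walk_cross_side e s h k :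
  walk s h k -> h \in side e -> k \notin side e -> e \in s.
Proof.
elim: s h => [|f s IHs] h; first by move=> /eqP-> ->.
case/walk_consP=> u fhu suk hS kS; rewrite inE.
by have [//|fe] := eqVneq e f; apply: (IHs u) => //; rewrite -(side_joins _ fhu) // eq_sym.
Qed.

Lemma shortest_path_exists h k : graph_connected src tgt ->
  exists s, shortest_path src tgt s h k.
Proof.
case/(_ h k)=> s0 ws0.
(* Quantifying over tuples of fixed length keeps the predicate boolean, so a minimal length can be
   extracted. *)
have exP : exists d, [exists t : d.-tuple 'I_p, walk t h k].
  by exists (size s0); apply/existsP; exists (in_tuple s0).
case: (ex_minnP exP) => d /existsP[t wt] dmin; exists t; split=> // s ws.
by rewrite size_tuple; apply: dmin; apply/existsP; exists (in_tuple s).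
Qed.

(** Every walk leaving the side of e uses e, in particular a shortest one. *)
Lemma cut_in_span_paths (S : {set 'I_n}) e : graph_connected src tgt ->
  side e :&: S != set0 -> ~~ (S \subset side e) -> in_span_paths src tgt S e.
Proof.
move=> conn /set0Pn[h /setIP[hs hS]] /subsetPn[k kS ks].
have [s sP] := shortest_path_exists h k conn.
exists h, k; split=> //; exists s => //.
by case: sP => w _; apply: walk_cross_side w hs ks.
Qed.

(** The matrix B of the overview: one fundamental cut per column. *)
Definition side_mx (K : nzRingType) : 'M[K]_(n, p) :=
  \matrix_(v, e) (v \in side e)%:R.

(** Entry (e, f) is the jump along e of the indicator of [side f], and f is the only edge across
    which it jumps. *)
Lemma incidence_side_mx (R : rcfType) : acyclic src tgt ->
  incidence R src tgt *m side_mx R[i] = 1%:M.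
Proof.
move=> acyc; apply/matrixP => e f; rewrite !mxE.
have st := acyclic_src_tgt e acyc.
rewrite (bigD1 (src e)) //= (bigD1 (tgt e)) /=; last by rewrite eq_sym.
rewrite big1 ?addr0; last first.
  by move=> v /andP[vs vt]; rewrite !mxE (negPf vs) (negPf vt) mul0r.
rewrite !mxE eqxx eq_sym (negPf st) eqxx mulN1r mul1r.
have [->|ef] := eqVneq e f.
  by rewrite mem_side_tgt (negPf (acyclic_src_side f acyc)) oppr0 add0r.
by rewrite (side_edge ef) addNr.
Qed.

End Walks.

(** * Projections attached to clusters *)

Section Proj.
Variables (R : rcfType) (n : nat) (C : {set 'I_n}).
Implicit Types S T : {set 'I_n}.
Local Notation Omega := (Omega R C).
Local Notation indic := (@indic R n C).

Lemma indicC : indic C = const_mx 1.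
Proof. by apply/colP => i; rewrite !mxE enum_valP. Qed.

Lemma indic_dot S T : S \subset C ->
  (indic T)^T *m indic S = (#|T :&: S|%:R)%:M.
Proof.
move=> sSC; apply/matrixP => i j; rewrite !ord1 !mxE mulr1n.
under eq_bigr => k _ do rewrite !mxE -natrM mulnb -in_setI.
rewrite -natr_sum -(big_enum_val (A := mem C) (fun v => nat_of_bool (v \in T :&: S))).
rewrite -big_mkcondr sum1_card; congr (_%:R); apply: eq_card => v.
rewrite -topredE /= !inE; case: (boolP (v \in S)) => [/(subsetP sSC)->|] //.
by rewrite !andbF.
Qed.

Lemma indic_Omega S T : S \subset C ->
  (indic T)^T *m Omega S =
  (indic (T :&: S))^T - (#|T :&: S|%:R / #|S|%:R) *: (indic S)^T.
Proof.
move=> sSC; rewrite mulmxBr -scalemxAr mulmxA indic_dot // mul_scalar_mx scalerA mulrC.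
congr (_ - _); apply/rowP => j; rewrite mul_mx_diag !mxE -natrM mulnb.
by rewrite in_setI.
Qed.

Lemma Omega_sym S : (Omega S)^T = Omega S.
Proof. by rewrite linearB linearZ /= tr_diag_mx trmx_mul trmxK. Qed.

(** [Omega S] restricts to S and subtracts the mean, so its columns sum to zero over S. Used with T
    = C for zero sums and with T a side of a cut. *)
Lemma indic_super_Omega S T : S \subset T -> S \subset C -> (0 < #|S|)%N ->
  (indic T)^T *m Omega S = 0.
Proof.
move=> sST sSC S0; rewrite indic_Omega // (setIidPr sST) divff ?scale1r ?subrr //.
by rewrite pnatr_eq0 -lt0n.
Qed.

Lemma indic_disj_Omega S T : T :&: S = set0 -> S \subset C ->
  (indic T)^T *m Omega S = 0.
Proof.
move=> TS0 sSC; rewrite indic_Omega // TS0 cards0 mul0r scale0r subr0.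
by apply/rowP => j; rewrite !mxE inE.
Qed.

Lemma Omega_entry S k (A : 'M[R]_(#|C|, k)) i j :
  (Omega S *m A) i j = (enum_val i \in S)%:R * (A i j - #|S|%:R^-1 * ((indic S)^T *m A) 0 j).
Proof.
rewrite mulmxBl mul_diag_mx -scalemxAl -mulmxA !mxE big_ord1 !mxE.
by rewrite mulrBr; congr (_ - _); rewrite mulrCA.
Qed.

Lemma Omega_idem S T : S \subset T -> T \subset C -> (0 < #|S|)%N ->
  Omega T *m Omega S = Omega S.
Proof.
move=> sST sTC S0; have sSC := subset_trans sST sTC; apply/matrixP => i j.
rewrite Omega_entry indic_super_Omega // [(0 : 'rV[R]_#|C|) _ _]mxE mulr0 subr0.
rewrite -[Omega S]mulmx1 Omega_entry mulrA -natrM mulnb.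
by case: (boolP (_ \in S)) => [/(subsetP sST)-> //|]; rewrite andbF.
Qed.

Lemma mxtrace_Omega S : S \subset C -> (0 < #|S|)%N -> \tr (Omega S) = #|S|%:R - 1.
Proof.
move=> sSC S0; rewrite linearB linearZ /= mxtrace_mulC indic_dot // setIid.
rewrite mxtrace_scalar mulr1n mulVf ?pnatr_eq0 -?lt0n //; congr (_ - 1).
have /matrixP/(_ 0 0) := indic_dot C sSC.
rewrite (setIidPr sSC) indicC !mxE mulr1n => <-; apply: eq_bigr => i _.
by rewrite !mxE eqxx mulr1n mul1r.
Qed.

End Proj.

(** * The projection attached to one cluster *)

Lemma pinvP (R : realFieldType) m n (A : 'M[R]_(m, n)) : is_pinv A (pinv A).
Proof. exact: xchooseP. Qed.

(** The transpose also solves the Penrose equations of A, whose solution is unique. *)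
Lemma pinv_sym (R : realFieldType) m (A : 'M[R]_m) : A^T = A -> (pinv A)^T = pinv A.
Proof.
move=> sA; have /and4P[/eqP a /eqP b /eqP c /eqP d] := pinvP A.
have PA : A *m (pinv A)^T = pinv A *m A by rewrite -d trmx_mul sA.
have AP : (pinv A)^T *m A = A *m pinv A by rewrite -c trmx_mul sA.
apply: (@pinv_unique _ _ _ A) (pinvP A); apply/and4P; split; apply/eqP.
- by rewrite -[in RHS]sA -[in RHS]a !trmx_mul sA mulmxA.
- by rewrite -[in RHS]b !trmx_mul sA mulmxA.
- by rewrite PA d.
- by rewrite AP c.
Qed.

Definition sum_zero_pd (R : rcfType) n (C : {set 'I_n}) (M : 'M[R]_#|C|) :=
  forall x : 'cV[R]_#|C|, (indic R C C)^T *m x = 0 ->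
  0 <= (x^T *m M *m x) 0 0 ?= iff (x == 0).

Section Cluster.
Variables (R : rcfType) (n : nat) (C : {set 'I_n}) (M : 'M[R]_#|C|).
Hypotheses (Msym : M^T = M) (Mpd : sum_zero_pd M).
Local Notation one := (indic R C C).

Lemma sum_zero_gram0 k (A : 'M[R]_(#|C|, k)) :
  one^T *m A = 0 -> A^T *m M *m A = 0 -> A = 0.
Proof.
move=> A1 AMA; apply/matrixP => i j.
have cA1 : one^T *m col j A = 0 by rewrite colE mulmxA A1 mul0mx.
have [_] := Mpd cA1.
have -> : (col j A)^T *m M *m col j A = 0.
  by rewrite colE trmx_mul -!mulmxA (mulmxA M) (mulmxA A^T) (mulmxA A^T) AMA mul0mx mulmx0.
rewrite mxE eqxx => /esym/eqP/colP/(_ i).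
by rewrite !mxE.
Qed.

Variable S : {set 'I_n}.
Hypotheses (sSC : S \subset C) (S0 : (0 < #|S|)%N).
Local Notation Om := (Omega R C S).
Local Notation N := (Om *m M *m Om).
Local Notation P := (pinv N).

Let OmOm : Om *m Om = Om. Proof. exact: Omega_idem. Qed.
Let Nsym : N^T = N.
Proof. by rewrite !trmx_mul Omega_sym Msym mulmxA. Qed.
Let Psym : P^T = P. Proof. exact: pinv_sym. Qed.
Let PNP : P *m N *m P = P. Proof. by have /and4P[_ /eqP] := pinvP N. Qed.
Let NPN : N *m P *m N = N. Proof. by have /and4P[/eqP] := pinvP N. Qed.

(** The symmetric N commutes with P, so P = P N P = N P P, and N starts with a factor [Om]. *)
Let Omega_pinv : Om *m P = P.
Proof.
have /and4P[_ _ _ /eqP PN] := pinvP N.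
have PE : P = N *m P *m P by rewrite -[LHS]PNP -PN trmx_mul Psym Nsym.
transitivity (Om *m (N *m P *m P)); first by rewrite -PE.
by rewrite [RHS]PE !mulmxA OmOm.
Qed.

Let pinv_Omega : P *m Om = P.
Proof. by apply: trmx_inj; rewrite trmx_mul Omega_sym Psym Omega_pinv. Qed.

(** P inverts N on the image of [Om]: the defect D lies in that image and N D = 0, so D^T M D = D^T
    N D = 0 and definiteness gives D = 0. *)
Let pinv_compression : P *m N = Om.
Proof.
apply/esym/eqP; rewrite -subr_eq0; apply/eqP; set D := _ - _.
have OD : Om *m D = D by rewrite mulmxBr OmOm mulmxA Omega_pinv.
have NO : N *m Om = N by rewrite -mulmxA OmOm.
have ND : N *m D = 0 by rewrite mulmxBr NO mulmxA NPN subrr.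
apply: sum_zero_gram0; first by rewrite -OD mulmxA indic_super_Omega ?mul0mx.
have -> : D^T *m M *m D = D^T *m (N *m D).
  by rewrite -{1 2}OD trmx_mul Omega_sym !mulmxA.
by rewrite ND mulmx0.
Qed.

Lemma Ecl_OmegaK : Ecl M S *m Om = Om.
Proof. by rewrite -[RHS]pinv_compression !mulmxA pinv_Omega. Qed.

(** Exposes the factor [Om *m M], on which the orthogonality of disjoint clusters acts. *)
Lemma Ecl_compressE : Ecl M S = P *m Om *m M.
Proof. by rewrite pinv_Omega. Qed.

Lemma Omega_EclK : Om *m Ecl M S = Ecl M S.
Proof. by rewrite /Ecl mulmxA Omega_pinv. Qed.

Lemma mxtrace_Ecl : \tr (Ecl M S) = #|S|%:R - 1.
Proof. by rewrite -Omega_EclK mxtrace_mulC Ecl_OmegaK mxtrace_Omega. Qed.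

(** Both sides equal M P M, because P M P = P. This turns x^T M E x into the squared M-norm of E
    x. *)
Lemma Ecl_selfadjoint : M *m Ecl M S = (Ecl M S)^T *m M *m Ecl M S.
Proof.
have PMP : P *m M *m P = P.
  move: (pinv N) Omega_pinv pinv_Omega PNP => Q OQ QO QNQ.
  by rewrite -[RHS]QNQ !mulmxA QO -[RHS]mulmxA OQ.
by rewrite /Ecl trmx_mul Msym Psym -{1}PMP !mulmxA.
Qed.

(** Penrose symmetry gives [Om] = P N = N P, so [Om] M A = N (E A). Hence M x is constant on S
    whenever E x = 0. *)
Lemma Omega_mul_Ecl0 k (A : 'M[R]_(#|C|, k)) : Ecl M S *m A = 0 -> Om *m (M *m A) = 0.
Proof.
move=> EA; rewrite -pinv_compression -[P *m N]trmxK trmx_mul Nsym Psym.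
have /and4P[_ _ /eqP NP _] := pinvP N.
have -> : (N *m P)^T = N *m P by [].
by rewrite -(mulmxA N) [P *m _]mulmxA EA mulmx0.
Qed.

Lemma sum_zero_Ecl k (A : 'M[R]_(#|C|, k)) : one^T *m (Ecl M S *m A) = 0.
Proof. by rewrite -Omega_EclK !mulmxA indic_super_Omega ?mul0mx. Qed.

End Cluster.

(** * The kernel of the average *)

Section Average.
Variables (R : rcfType) (n : nat) (C : {set 'I_n}) (M : 'M[R]_#|C|).
Hypotheses (Msym : M^T = M) (Mpd : sum_zero_pd M).
Local Notation one := (indic R C C).
Variables (l : nat) (Cl : 'I_l -> {set 'I_n}) (rho : 'I_l -> R).
Hypotheses (clC : clustering C Cl) (cl0 : forall r, (0 < #|Cl r|)%N).

Lemma cluster_sub r : Cl r \subset C.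
Proof. by case: clC. Qed.
Local Hint Resolve cluster_sub : core.

Lemma sum_zero_Eave k (A : 'M[R]_(#|C|, k)) : one^T *m (Eave M Cl rho *m A) = 0.
Proof.
rewrite mulmx_suml mulmx_sumr big1 // => r _.
by rewrite -scalemxAl -scalemxAr sum_zero_Ecl // scaler0.
Qed.

(** By self-adjointness, x^T M E_ave x is the sum of the squared M-norms of the E_r x with positive
    weights, so each term vanishes. *)
Lemma Eave_ker (x : 'cV[R]_#|C|) : (forall r, 0 < rho r) -> Eave M Cl rho *m x = 0 ->
  forall r, Ecl M (Cl r) *m x = 0.
Proof.
move=> rho0 Ex.
pose y r := Ecl M (Cl r) *m x.
have y1 r : one^T *m y r = 0 by apply: sum_zero_Ecl.
have : \sum_r rho r * ((y r)^T *m M *m y r) 0 0 = 0.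
  transitivity ((x^T *m M *m (Eave M Cl rho *m x)) 0 0); last by rewrite Ex mulmx0 mxE.
  rewrite mulmx_suml mulmx_sumr summxE; apply: eq_bigr => r _.
  rewrite -scalemxAl -scalemxAr [RHS]mxE; congr (_ * _).
  have -> : x^T *m M *m (Ecl M (Cl r) *m x) = x^T *m (M *m Ecl M (Cl r)) *m x by rewrite !mulmxA.
  by rewrite Ecl_selfadjoint // /y trmx_mul !mulmxA.
move/eqP; rewrite psumr_eq0; last by move=> r _; rewrite mulr_ge0 ?(ltW (rho0 r)) ?(Mpd (y1 r)).
move=> /allP/(_ _ (mem_index_enum _)) H r.
have {}H := H r; rewrite /= mulf_eq0 gt_eqF //= in H.
by apply/eqP; rewrite -(Mpd (y1 r)).2 eq_sym.
Qed.

(** Consecutive clusters of a chain share a node, so their constants agree. *)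
Lemma hyper_connected_const (f : 'I_#|C| -> R) (a : 'I_l -> R) :
  hyper_connected C Cl -> (forall r i, enum_val i \in Cl r -> f i = a r) ->
  forall i j, f i = f j.
Proof.
move=> conn fa i j.
have [r [s [ir js rs]]] := conn _ _ (enum_valP i) (enum_valP j).
rewrite (fa r) // (fa s) //.
case/connectP: rs => q qP ->; elim: q r qP {ir} => //= t q IHq r /andP[rt tq].
rewrite -IHq //; case/set0Pn: rt => v /setIP[vr vt].
have vC : v \in C by apply: subsetP vr.
by rewrite -(fa r (enum_rank_in vC v)) ?(fa t) // enum_rankK_in.
Qed.

(** M x equals its mean on each cluster, hence is constant on C by connectedness; paired with the
    zero-sum x it gives x^T M x = 0. *)
Lemma Eave_inj (x : 'cV[R]_#|C|) : hyper_connected C Cl -> (forall r, 0 < rho r) ->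
  one^T *m x = 0 -> Eave M Cl rho *m x = 0 -> x = 0.
Proof.
move=> conn rho0 x1 /(Eave_ker rho0) Ex.
have Mx : forall i j, (M *m x) i 0 = (M *m x) j 0.
  apply: (@hyper_connected_const _
    (fun r => #|Cl r|%:R^-1 * ((indic R C (Cl r))^T *m (M *m x)) 0 0) conn) => r i ir.
  have /colP/(_ i) := Omega_mul_Ecl0 Msym Mpd (cluster_sub r) (cl0 r) (Ex r).
  by rewrite Omega_entry ir mul1r [RHS]mxE => /eqP; rewrite subr_eq0 => /eqP.
apply: (sum_zero_gram0 Mpd) => //.
apply/matrixP => a b; rewrite !ord1 -mulmxA [RHS]mxE mxE.
case: (posnP #|C|) => [C0|C0]; first by rewrite big1 // => i; have := ltn_ord i; rewrite {2}C0.
under eq_bigr => i _ do rewrite (Mx i (Ordinal C0)).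
have x1_00 : \sum_i x^T 0 i = 0.
  have /matrixP/(_ 0 0) := x1; rewrite [RHS]mxE mxE => {2}<-.
  by apply: eq_bigr => i _; rewrite indicC !mxE mul1r.
by rewrite -mulr_suml x1_00 mul0r.
Qed.

End Average.

(** * Spectra *)

Section Spectrum.
Variable R : rcfType.
Local Notation toC := (real_complex R).

(** [eigenvalue] refers to row vectors; transposition preserves the characteristic polynomial. *)
Lemma ceigenvalue_colP m (A : 'M[R]_m) (a : R[i]) :
  reflect (exists2 x : 'cV[R[i]]_m, map_mx toC A *m x = a *: x & x != 0)
          (ceigenvalue A a).
Proof.
set B := map_mx _ A; rewrite /ceigenvalue -/B eigenvalue_root_char.
have -> : char_poly B = char_poly B^T.
  rewrite /char_poly -det_tr; congr (\det _).
  by rewrite /char_poly_mx linearB /= tr_scalar_mx map_trmx.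
rewrite -eigenvalue_root_char.
apply: (iffP eigenvalueP) => [[v vB v0]|[x Bx x0]].
  exists v^T; last by rewrite trmx_eq0.
  by apply: trmx_inj; rewrite trmx_mul trmxK vB linearZ /= trmxK.
exists x^T; last by rewrite trmx_eq0.
by rewrite -trmx_mul Bx linearZ.
Qed.

Lemma ceigenvalue_realcol m (A : 'M[R]_m) (a : R) (x : 'cV[R]_m) :
  A *m x = a *: x -> x != 0 -> ceigenvalue A a%:C.
Proof.
move=> Ax x0; apply/ceigenvalue_colP; exists (map_mx toC x).
  by rewrite -map_mxM Ax map_mxZ.
by rewrite map_mx_eq0.
Qed.

Lemma ceigenvalue1B m (E : 'M[R]_m) a :
  ceigenvalue (1%:M - E) a = ceigenvalue E (1 - a).
Proof.
rewrite /ceigenvalue map_mxB map_mx1.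
apply/eigenvalueP/eigenvalueP => -[v vE v0]; exists v => //.
  by rewrite scalerBl scale1r -vE mulmxBr mulmx1 subKr.
by rewrite mulmxBr mulmx1 vE scalerBl scale1r subKr.
Qed.

(** The eigenvalues are finitely many roots; a ensures that some root differs from 1. *)
Lemma is_beta_exists m (F : 'M[R]_m) a :
  ceigenvalue F a -> a != 1 -> exists2 b, is_beta F b & `|a| <= b%:C.
Proof.
(* Norms live in the partially ordered [R[i]]; f is their real value, where the order is total. *)
move=> Fa a1; pose f : R[i] -> R := fun c => complex.Re `|c|.
have normE c : `|c| = (f c)%:C by rewrite /f normc_def.
have [rs Ers] := closed_field_poly_normal (char_poly (map_mx toC F)).
have lead0 : lead_coef (char_poly (map_mx toC F)) != 0.
  by rewrite (monicP (char_poly_monic _)) oner_eq0.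
have memE c : ceigenvalue F c = (c \in rs).
  by rewrite /ceigenvalue eigenvalue_root_char Ers rootZ ?root_prod_XsubC.
pose qs := [seq c <- rs | c != 1].
have qsE c : (c \in qs) = ceigenvalue F c && (c != 1) by rewrite mem_filter memE andbC.
have aq : a \in qs by rewrite qsE Fa.
have [c cq cmax] : exists2 c, c \in qs & forall d, d \in qs -> f d <= f c.
  elim: (qs) (a) aq => // d q IHq _ _; case: q IHq => [|e q] IHq.
    by exists d; rewrite ?mem_head // => d'; rewrite inE => /eqP->.
  have [c cq cmax] := IHq e (mem_head _ _).
  have [le|lt] := leP (f d) (f c).
    exists c; first by rewrite inE cq orbT.
    by move=> d'; rewrite inE => /predU1P[->|/cmax].
  exists d; first exact: mem_head.
  by move=> d'; rewrite inE => /predU1P[->|/cmax/le_trans] //; apply; apply: ltW.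
exists (f c); last by rewrite normE lecR cmax.
split; first by exists c; move: cq; rewrite qsE normE => /andP[].
by move=> d Fd d1; rewrite normE lecR cmax // qsE Fd.
Qed.

(** The trace is the sum of the k roots of the characteristic polynomial, so their real parts have
    mean tr K / k and one does not exceed it. *)
Lemma ceigenvalue_le_mean k (K : 'M[R]_k) : (0 < k)%N ->
  exists2 a, ceigenvalue K a & complex.Re a <= \tr K / k%:R.
Proof.
move=> k0; have k0R : 0 < k%:R :> R by rewrite ltr0n.
have [rs Ers] := closed_field_poly_normal (char_poly (map_mx toC K)).
rewrite (monicP (char_poly_monic _)) scale1r in Ers.
have sz : size rs = k.
  by have := size_char_poly (map_mx toC K); rewrite Ers size_prod_XsubC => -[].
have Etr : \sum_(c <- rs) complex.Re c = \tr K.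
  have : \sum_(c <- rs) c = (\tr K)%:C.
    apply: oppr_inj; rewrite -coefPn_prod_XsubC ?sz -?lt0n // -Ers char_poly_trace //.
    by rewrite -trace_map_mx.
  move=> /(congr1 (@complex.Re R)) /= <-.
  by elim: (rs) => [|c q IHq]; rewrite ?big_nil // !big_cons raddfD /= IHq.
case: (boolP (has (fun c => complex.Re c <= \tr K / k%:R) rs)).
  case/hasP=> c crs le; exists c => //.
  by rewrite /ceigenvalue eigenvalue_root_char Ers root_prod_XsubC.
rewrite -all_predC => /allP gt.
suff : \tr K < \tr K by rewrite ltxx.
rewrite -{2}Etr.
have -> : \tr K = \sum_(c <- rs) (\tr K / k%:R).
  by rewrite big_const_seq count_predT sz iter_addr_0 -[_ *+ k]mulr_natr divfK ?gt_eqF.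
rewrite !big_seq; apply: ltr_sum.
  case: rs sz {Ers Etr gt} => [|c q] sz; first by rewrite -sz in k0.
  by rewrite /= mem_head.
by move=> c /gt /=; rewrite -ltNge.
Qed.

(** The default value 1 bounds every probability, and total mass 1 excludes l = 0, so the minimum is
    attained. *)
Lemma min_probP l (rho : 'I_l -> R) : pos_prob rho ->
  exists2 r, min_prob rho = rho r & forall s, rho r <= rho s.
Proof.
case=> rho0 rho1.
have rho_le1 r : rho r <= 1.
  by rewrite -rho1 (bigD1 r) //= lerDl sumr_ge0 // => s _; apply: ltW.
have [r0 _] : exists r : 'I_l, true.
  case: l rho rho0 rho1 {rho_le1} => [|l] rho _ rho1; last by exists ord0.
  by move: rho1; rewrite big_ord0 => /esym/eqP; rewrite oner_eq0.
have [r _ Er] := eq_bigmin (x := 1) r0 predT rho isT (fun s _ => rho_le1 s).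
by exists r => // s; rewrite -Er; apply: bigmin_le.
Qed.

Lemma min_prob_le l (rho : 'I_l -> R) : pos_prob rho -> min_prob rho <= l%:R^-1.
Proof.
move=> prho; have [r -> rmin] := min_probP prho; case: prho => _ rho1.
have l0 : 0 < l%:R :> R by case: l r {rho rmin rho1} => [[]|] // l _; rewrite ltr0n.
rewrite -[_^-1]mul1r ler_pdivlMr // -[leRHS]rho1.
rewrite mulr_natr -[X in _ *+ X]card_ord -sumr_const.
by apply: ler_sum => s _.
Qed.

Lemma uniform_pos_prob l : (0 < l)%N -> pos_prob (@uniform_prob R l).
Proof.
move=> l0; have l0R : 0 < l%:R :> R by rewrite ltr0n.
split=> [r|]; first by rewrite invr_gt0.
by rewrite sumr_const card_ord -[_ *+ l]mulr_natr mulVf // gt_eqF.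
Qed.

Lemma min_uniform_prob l : (0 < l)%N -> min_prob (@uniform_prob R l) = l%:R^-1.
Proof. by move=> /uniform_pos_prob/min_probP[r ->]. Qed.

End Spectrum.

(** * The Green matrix of a tree *)

Section Green.
Variables (R : rcfType) (n p : nat) (src tgt : 'I_p -> 'I_n).
Variables (z : 'I_p -> R[i]) (o : 'I_n) (X : 'M[R[i]]_n).
Hypotheses (acyc : acyclic src tgt) (z_re_gt0 : forall e, 0 < complex.Re (z e)).
Hypothesis Xgreen : is_green src tgt z o X.
Local Notation A := (incidence R src tgt).
Local Notation B := (side_mx src tgt R[i]).
Local Notation Z := (diag_mx (\row_e z e)).

Lemma impedance_unit : Z \in unitmx.
Proof.
rewrite unitmxE det_diag unitfE; apply/prodf_neq0 => e _; rewrite mxE.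
by apply: contraTneq (z_re_gt0 e) => ->; rewrite ltxx.
Qed.

(** Transposing the equation of X gives L X = I - 1_0 1^T, which fixes zero-sum vectors. With X x as
    potentials, the parenthesis holds the edge currents. *)
Lemma green_flow k (x : 'M[R[i]]_(n, k)) : (const_mx 1 : 'cV_n)^T *m x = 0 ->
  x = A^T *m (invmx Z *m A *m X *m x).
Proof.
case: Xgreen => Xsym XL _ x1.
have Lsym : (laplacian src tgt z)^T = laplacian src tgt z.
  by rewrite /laplacian !trmx_mul trmxK trmx_inv tr_diag_mx mulmxA.
have LX : laplacian src tgt z *m X = 1%:M - (delta_mx o 0 : 'cV_n) *m (const_mx 1 : 'cV_n)^T.
  apply: trmx_inj; rewrite trmx_mul Xsym Lsym XL linearB /= trmx1.
  by rewrite trmx_mul trmxK.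
rewrite !mulmxA -[A^T *m _ *m A]/(laplacian src tgt z) LX.
by rewrite mulmxBl mul1mx -mulmxA x1 mulmx0 subr0.
Qed.

(** B^T A^T = I: the current in an edge is the total injection on its target side. *)
Lemma side_flow k (x : 'M[R[i]]_(n, k)) : (const_mx 1 : 'cV_n)^T *m x = 0 ->
  B^T *m x = invmx Z *m A *m X *m x.
Proof.
move=> x1; rewrite {1}(green_flow x1) mulmxA -trmx_mul incidence_side_mx //.
by rewrite trmx1 mul1mx.
Qed.

(** Both sides equal (B^T x)^T A X y, by [green_flow] for x and [side_flow] for y. *)
Lemma green_form k k' (x : 'M[R[i]]_(n, k)) (y : 'M[R[i]]_(n, k')) :
  (const_mx 1 : 'cV_n)^T *m x = 0 -> (const_mx 1 : 'cV_n)^T *m y = 0 ->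
  x^T *m X *m y = (B^T *m x)^T *m Z *m (B^T *m y).
Proof.
move=> x1 y1; rewrite [B^T *m y]side_flow // -!mulmxA mulKVmx ?impedance_unit //.
by rewrite {1}(green_flow x1) -side_flow // [(A^T *m _)^T]trmx_mul trmxK !mulmxA.
Qed.

Lemma side_inj k (x : 'M[R[i]]_(n, k)) : (const_mx 1 : 'cV_n)^T *m x = 0 ->
  B^T *m x = 0 -> x = 0.
Proof. by move=> x1; rewrite side_flow // => fx0; rewrite (green_flow x1) fx0 mulmx0. Qed.

End Green.

(** * Real parts and restriction to the compensators *)

Section ReGreen.
Variables (R : rcfType) (n p : nat) (src tgt : 'I_p -> 'I_n).
Variables (z : 'I_p -> R[i]) (o : 'I_n) (X : 'M[R[i]]_n) (C : {set 'I_n}).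
Hypotheses (acyc : acyclic src tgt) (z_re_gt0 : forall e, 0 < complex.Re (z e)).
Hypothesis Xgreen : is_green src tgt z o X.
Local Notation toC := (real_complex R).
Local Notation M := (re_submx C X).
Local Notation one := (indic R C C).

Lemma Re_mul_reall (a : R) (c : R[i]) : complex.Re (a%:C * c) = a * complex.Re c.
Proof. by case: c => x y /=; rewrite mul0r subr0. Qed.

Lemma Re_mul_realr (a : R) (c : R[i]) : complex.Re (c * a%:C) = complex.Re c * a.
Proof. by rewrite mulrC Re_mul_reall mulrC. Qed.

Lemma map_Re_mul k m q r (P : 'M[R]_(k, m)) (Y : 'M[R[i]]_(m, q)) (Q : 'M[R]_(q, r)) :
  map_mx (@complex.Re R) (map_mx toC P *m Y *m map_mx toC Q) =
  P *m map_mx (@complex.Re R) Y *m Q.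
Proof.
apply/matrixP => i j; rewrite !mxE raddf_sum; apply: eq_bigr => a _ /=.
rewrite !mxE Re_mul_realr; congr (_ * _); rewrite raddf_sum; apply: eq_bigr => b _ /=.
by rewrite !mxE Re_mul_reall.
Qed.

(* Extension by zero from R^C to R^V. *)
Definition ext_mx : 'M[R]_(n, #|C|) := \matrix_(v, i) (v == enum_val i)%:R.

Lemma re_submxE : M = ext_mx^T *m map_mx (@complex.Re R) X *m ext_mx.
Proof.
apply/matrixP => i j; rewrite !mxE (bigD1 (enum_val j)) //= big1 ?addr0; last first.
  by move=> v vj; rewrite [ext_mx _ _]mxE (negPf vj) mulr0.
rewrite !mxE eqxx mulr1 (bigD1 (enum_val i)) //= big1 ?addr0; last first.
  by move=> v vi; rewrite !mxE (negPf vi) mul0r.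
by rewrite !mxE eqxx mul1r.
Qed.

Lemma ext_mx_inj k (x : 'M[R]_(#|C|, k)) : ext_mx *m x = 0 -> x = 0.
Proof.
move=> Jx; apply/matrixP => i j; have /matrixP/(_ (enum_val i) j) := Jx.
rewrite !mxE (bigD1 i) //= big1 ?addr0; last first.
  by move=> a ai; rewrite mxE (inj_eq enum_val_inj) eq_sym (negPf ai) mul0r.
by rewrite mxE eqxx mul1r.
Qed.

Lemma mul_ext_mx k (Y : 'M[R]_(k, n)) a i : (Y *m ext_mx) a i = Y a (enum_val i).
Proof.
rewrite !mxE (bigD1 (enum_val i)) //= big1 ?addr0; last first.
  by move=> v vi; rewrite mxE (negPf vi) mulr0.
by rewrite mxE eqxx mulr1.
Qed.

Lemma ext_mx_sum0 k (x : 'M[R]_(#|C|, k)) : one^T *m x = 0 ->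
  (const_mx 1 : 'cV_n)^T *m map_mx toC (ext_mx *m x) = 0.
Proof.
have -> : (const_mx 1 : 'cV_n)^T = map_mx toC (const_mx 1 : 'cV_n)^T.
  by rewrite -map_trmx map_const_mx rmorph1.
have -> : one^T = (const_mx 1 : 'cV_n)^T *m ext_mx.
  by apply/matrixP => a i; rewrite mul_ext_mx indicC !mxE.
by rewrite -map_mxM mulmxA => ->; rewrite map_mx0.
Qed.

(** B^T restricted to C; it sends zero-sum injections to edge currents. *)
Definition cut_mx : 'M[R]_(p, #|C|) := (side_mx src tgt R)^T *m ext_mx.

Lemma row_cut_mx e : row e cut_mx = (indic R C (side src tgt e))^T.
Proof. by apply/rowP => i; rewrite mxE mul_ext_mx !mxE. Qed.

Local Notation ReZ := (diag_mx (\row_e complex.Re (z e))).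

Lemma map_side_mx : map_mx toC (side_mx src tgt R) = side_mx src tgt R[i].
Proof. by apply/matrixP => v e; rewrite !mxE rmorph_nat. Qed.

Lemma re_green_form k k' (x : 'M[R]_(#|C|, k)) (y : 'M[R]_(#|C|, k')) :
  one^T *m x = 0 -> one^T *m y = 0 ->
  x^T *m M *m y = (cut_mx *m x)^T *m ReZ *m (cut_mx *m y).
Proof.
move=> x1 y1; have /= := green_form acyc z_re_gt0 Xgreen (ext_mx_sum0 x1) (ext_mx_sum0 y1).
move/(congr1 (map_mx (@complex.Re R))).
rewrite -map_side_mx !map_trmx -!map_mxM !map_trmx !map_Re_mul.
have -> : map_mx (@complex.Re R) (diag_mx (\row_e z e)) = ReZ.
  by apply/matrixP => e f; rewrite !mxE raddfMn.
by rewrite re_submxE trmx_mul !mulmxA.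
Qed.

Lemma cut_mx_inj k (x : 'M[R]_(#|C|, k)) :
  one^T *m x = 0 -> cut_mx *m x = 0 -> x = 0.
Proof.
move=> x1 cx; apply: ext_mx_inj; apply/eqP; rewrite -(map_mx_eq0 toC); apply/eqP.
apply: (side_inj acyc Xgreen (ext_mx_sum0 x1)).
by rewrite -map_side_mx map_trmx -map_mxM mulmxA cx map_mx0.
Qed.

Lemma re_submx_sym : M^T = M.
Proof. by case: Xgreen => Xs _ _; apply/matrixP => i j; rewrite !mxE -{1}Xs mxE. Qed.

(** The form is the sum of Re(z_e) f_e^2 over the edges, with f the currents, and [cut_mx_inj]
    settles the case f = 0. *)
Lemma re_submx_pd : sum_zero_pd M.
Proof.
move=> x x1; rewrite re_green_form //.
set f := cut_mx *m x.
have -> : (f^T *m ReZ *m f) 0 0 = \sum_e complex.Re (z e) * f e 0 ^+ 2.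
  move: f => f; rewrite mxE; apply: eq_bigr => e _.
  by rewrite mul_mx_diag !mxE mulrAC mulrC expr2.
have ge0 e : true -> 0 <= complex.Re (z e) * f e 0 ^+ 2.
  by rewrite mulr_ge0 ?sqr_ge0 // ltW.
split; first exact: sumr_ge0.
rewrite eq_sym psumr_eq0 //; apply/allP/eqP => [f0|x0 e _].
  apply: cut_mx_inj => //; apply/matrixP => e j; rewrite ord1 [RHS]mxE.
  by have /= := f0 e (mem_index_enum _); rewrite mulf_eq0 gt_eqF //= sqrf_eq0 => /eqP.
by rewrite /f x0 mulmx0 mxE expr0n mulr0 eqxx.
Qed.

(** The row of e in [cut_mx *m Omega R C U] vanishes unless e separates two nodes of U, thus lies on
    a path of U; no e does so for both S and T. *)
Lemma re_submx_disj (conn : graph_connected src tgt) (S T : {set 'I_n}) :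
  S \subset C -> T \subset C -> (0 < #|S|)%N -> (0 < #|T|)%N ->
  (forall e, ~ (in_span_paths src tgt S e /\ in_span_paths src tgt T e)) ->
  Omega R C S *m M *m Omega R C T = 0.
Proof.
move=> sSC sTC S0 T0 disj; rewrite -[X in X *m _ *m _]Omega_sym.
rewrite re_green_form ?indic_super_Omega //.
have cut0 (U : {set 'I_n}) e : U \subset C -> (0 < #|U|)%N ->
    row e (cut_mx *m Omega R C U) = 0 \/ in_span_paths src tgt U e.
  move=> sUC U0; rewrite row_mul row_cut_mx.
  have [/indic_disj_Omega->|meet] := eqVneq (side src tgt e :&: U) set0; auto.
  have [/indic_super_Omega->|nsub] := boolP (U \subset side src tgt e); auto.
  by right; apply: cut_in_span_paths.
apply/matrixP => i j; rewrite [RHS]mxE mxE big1 // => e _; rewrite mul_mx_diag.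
rewrite [X in X * _]mxE [_^T _ _]mxE.
have [/rowP/(_ i)|Se] := cut0 S e sSC S0.
  by rewrite [LHS]mxE [RHS]mxE => ->; rewrite !mul0r.
have [/rowP/(_ j)|Te] := cut0 T e sTC T0.
  by rewrite [LHS]mxE [RHS]mxE => ->; rewrite mulr0.
by case: (disj e).
Qed.

End ReGreen.

(** * Averages over clusters *)

Lemma unitmx_of_inj (F : fieldType) k (K : 'M[F]_k) :
  (forall u : 'cV_k, K *m u = 0 -> u = 0) -> K \in unitmx.
Proof.
move=> inj; rewrite -unitmx_tr -row_free_unit -kermx_eq0; apply/rowV0P => v.
move=> /sub_kermxP vK; apply: trmx_inj; rewrite trmx0; apply: inj.
by apply: trmx_inj; rewrite trmx_mul trmxK vK trmx0.
Qed.

(** Cancelling the full-rank factors in P Q P Q = P Q leaves Q P = 1. The columns of P are a basis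
    of the image of A. *)
Lemma idempotent_factor (F : fieldType) m (A : 'M[F]_m) : A *m A = A ->
  exists (P : 'M_(m, \rank A)) (Q : 'M_(\rank A, m)), P *m Q = A /\ Q *m P = 1%:M.
Proof.
move: (col_base A) (row_base A) (mulmx_base A) (row_base_free A) (col_base_full A).
move=> P Q PQ fQ fP AA; exists P, Q; split=> //.
apply: (row_free_inj fQ); apply: (row_full_inj fP).
by rewrite mul1mx !mulmxA PQ -mulmxA PQ AA.
Qed.

(** The eigenvalues of 1 - E other than 1 are the 1 - rho_s, real and in [0, 1), so the least
    probability gives the largest modulus. *)
Lemma is_beta_compl (R : rcfType) m (E : 'M[R]_m) l (rho : 'I_l -> R) :
  pos_prob rho ->
  (forall a : R[i], ceigenvalue E a <-> a = 0 \/ exists r, a = (rho r)%:C) ->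
  is_beta (1%:M - E) (1 - min_prob rho).
Proof.
move=> prho specE; have [r -> rmin] := min_probP prho; case: prho => rho0 rho1.
have rho_le1 s : rho s <= 1.
  by rewrite -rho1 (bigD1 s) //= lerDl sumr_ge0 // => t _; apply: ltW.
have norm1B s : `|1 - (rho s)%:C| = (1 - rho s)%:C.
  by rewrite ger0_norm ?subr_ge0 ?lecR // rmorphB.
split=> [|a].
  exists (1 - (rho r)%:C); split=> //.
    by rewrite ceigenvalue1B subKr; apply/specE; right; exists r.
  by rewrite -subr_eq0 addrAC subrr sub0r oppr_eq0 fmorph_eq0 gt_eqF.
rewrite ceigenvalue1B => /specE[/eqP|[s /eqP]].
  by rewrite subr_eq0 => /eqP<-; rewrite eqxx.
rewrite subr_eq addrC -subr_eq => /eqP<- _.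
by rewrite norm1B lecR lerB.
Qed.

Section Hyper.
Variables (R : rcfType) (n : nat) (C : {set 'I_n}) (M : 'M[R]_#|C|).
Hypotheses (Msym : M^T = M) (Mpd : sum_zero_pd M).
Variables (l : nat) (Cl : 'I_l -> {set 'I_n}).
Hypotheses (clC : clustering C Cl) (conn : hyper_connected C Cl).
Hypothesis cl0 : forall r, (0 < #|Cl r|)%N.
Local Notation toC := (real_complex R).
Local Notation one := (indic R C C).
Local Notation Om r := (Omega R C (Cl r)).
Local Notation Pi := (Omega R C C).
Let clS := cluster_sub clC.

Lemma FaveE (rho : 'I_l -> R) : \sum_r rho r = 1 -> Fave M Cl rho = 1%:M - Eave M Cl rho.
Proof.
move=> rho1; rewrite /Fave /Eave -[X in X - _]scale1r -rho1 scaler_suml -sumrB.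
by apply: eq_bigr => r _; rewrite -scalerBr rho1.
Qed.

Lemma mxtrace_Eave (rho : 'I_l -> R) :
  \tr (Eave M Cl rho) = \sum_r rho r * (#|Cl r|%:R - 1).
Proof. by rewrite raddf_sum; apply: eq_bigr => r _; rewrite /= mxtraceZ mxtrace_Ecl. Qed.

Lemma Omega_Eave (rho : 'I_l -> R) : Pi *m Eave M Cl rho = Eave M Cl rho.
Proof.
rewrite mulmx_sumr; apply: eq_bigr => r _.
by rewrite -scalemxAr -Omega_EclK // mulmxA Omega_idem.
Qed.

Lemma Eave_mean_eigen (rho : 'I_l -> R) : (1 < #|C|)%N -> (forall r, 0 < rho r) ->
  exists a, [/\ ceigenvalue (Eave M Cl rho) a, a != 0 &
    complex.Re a <= \tr (Eave M Cl rho) / (#|C|%:R - 1)].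
Proof.
move=> C1 rho0; have C0 := ltnW C1; set E := Eave M Cl rho.
have PiPi : Pi *m Pi = Pi by apply: Omega_idem.
have [P [Q [PQ QP]]] := idempotent_factor PiPi.
(* K is E_ave on the zero-sum vectors in the basis given by P: it has order m - 1 and the trace of
   E_ave, and [Eave_inj] makes it invertible. *)
pose K := Q *m E *m P.
have PK : P *m K = E *m P by rewrite /K !mulmxA PQ Omega_Eave.
have rk : (\rank Pi)%:R = #|C|%:R - 1 :> R.
  by rewrite -(mxtrace_Omega R (subxx C)) // -{2}PQ mxtrace_mulC QP mxtrace1.
have rk0 : (0 < \rank Pi)%N by rewrite -(ltr0n R) rk subr_gt0 ltr1n.
have trK : \tr K = \tr E.
  by rewrite /K -mulmxA mxtrace_mulC -mulmxA PQ mxtrace_mulC Omega_Eave.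
have KU : K \in unitmx.
  apply: unitmx_of_inj => u Ku.
  have Pu : P *m u = 0.
    apply: (Eave_inj Msym Mpd clC cl0 conn rho0).
      by rewrite -[P]mulmx1 -QP mulmxA PQ !mulmxA indic_super_Omega ?mul0mx.
    by rewrite mulmxA -PK -mulmxA Ku mulmx0.
  by rewrite -[u]mul1mx -QP -mulmxA Pu mulmx0.
have [a Ka aK] := ceigenvalue_le_mean K rk0.
have [x Kx x0] := ceigenvalue_colP _ _ Ka.
exists a; split; last by rewrite -rk -trK.
- apply/ceigenvalue_colP; exists (map_mx toC P *m x).
    by rewrite mulmxA -map_mxM -PK map_mxM -mulmxA Kx scalemxAr.
  apply: contra x0 => /eqP Px.
  by rewrite -[x]mul1mx -(map_mx1 toC) -QP map_mxM -mulmxA Px mulmx0.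
- apply: contra x0 => /eqP a0; move: Kx; rewrite a0 scale0r => Kx.
  by rewrite -[x](@mulKmx _ _ _ (map_mx toC K)) ?map_unitmx // Kx mulmx0.
Qed.

(** With a from [Eave_mean_eigen], 1 - a is an eigenvalue of F_ave other than 1, and beta >= |1 - a|
    >= 1 - Re a; the trace of E_ave is c - 1. *)
Lemma beta_lower_bound (rho : 'I_l -> R) c : (1 < #|C|)%N ->
  (forall r, #|Cl r| = c) -> pos_prob rho ->
  exists2 b, is_beta (Fave M Cl rho) b & 1 - (c%:R - 1) / (#|C|%:R - 1) <= b.
Proof.
move=> C1 clc [rho0 rho1]; rewrite FaveE //.
have [a [Ea a0 ale]] := Eave_mean_eigen C1 rho0.
have [|| b bP ab] := @is_beta_exists _ _ (1%:M - Eave M Cl rho) (1 - a).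
- by rewrite ceigenvalue1B subKr.
- by rewrite -subr_eq0 addrAC subrr sub0r oppr_eq0.
exists b => //; rewrite -lecR; apply: le_trans ab; apply: le_trans (normc_ge_Re _).
rewrite lecR; apply: le_trans (ler_norm _).
rewrite raddfB /= lerB // (le_trans ale) // mxtrace_Eave.
under eq_bigr => r _ do rewrite clc.
by rewrite -mulr_suml rho1 mul1r.
Qed.

(** * Edge-disjoint clusters: spectrum and cardinalities *)

Hypothesis disj : forall r s, r != s -> Om r *m M *m Om s = 0.

Lemma Ecl_Omega_disj r s : r != s -> Ecl M (Cl r) *m Om s = 0.
Proof.
move=> rs; rewrite Ecl_compressE //; move: (pinv _) => Q.
by rewrite -!mulmxA [Om r *m _]mulmxA disj // mulmx0.
Qed.

Lemma Eave_Omega (rho : 'I_l -> R) r : Eave M Cl rho *m Om r = rho r *: Om r.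
Proof.
rewrite mulmx_suml (bigD1 r) //= big1 ?addr0 => [|s sr].
  by rewrite -scalemxAl Ecl_OmegaK.
by rewrite -scalemxAl Ecl_Omega_disj // scaler0.
Qed.

Lemma ceigenvalue_Eave (rho : 'I_l -> R) (a : R[i]) :
  (0 < #|C|)%N -> (forall r, (1 < #|Cl r|)%N) ->
  ceigenvalue (Eave M Cl rho) a <-> a = 0 \/ exists r, a = (rho r)%:C.
Proof.
move=> C0 cl1; split=> [/eigenvalueP[v vE v0]|[->|[r ->]]]; last first.
(* A cluster with at least two nodes gives [Om r] a nonzero trace, hence a nonzero column. *)
- have : Om r != 0.
    apply/eqP => /(congr1 mxtrace); rewrite mxtrace_Omega // mxtrace0 => /eqP.
    by rewrite subr_eq0 pnatr_eq1 gtn_eqF.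
  case/matrix0Pn => i [j nz]; apply: (@ceigenvalue_realcol _ _ _ _ (col j (Om r))).
    by rewrite colE mulmxA Eave_Omega scalemxAl.
  by apply: contra nz => /eqP/colP/(_ i); rewrite !mxE => ->.
- rewrite /ceigenvalue -(rmorph0 toC) eigenvalue_map; apply/eigenvalueP.
  exists one^T; last first.
    rewrite trmx_eq0 indicC; apply/eqP => /colP/(_ (Ordinal C0))/eqP.
    by rewrite !mxE oner_eq0.
  by rewrite scale0r -[Eave _ _ _]mulmx1 sum_zero_Eave.
have [->|a0] := eqVneq a 0; [by left | right].
case: (pickP (fun r => a == (rho r)%:C)) => [r /eqP->|na]; first by exists r.
case/eqP: v0; apply/eqP; rewrite -(inj_eq (scalerI a0)) scaler0 -vE; apply/eqP.
(* The left eigenvector v satisfies a v Om_r = rho_r v Om_r with a different from rho_r. Since E_r =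
   Om_r E_r, then v E_ave = 0. *)
have vO r : v *m map_mx toC (Om r) = 0.
  have : v *m map_mx toC (Eave M Cl rho) *m map_mx toC (Om r) =
         (rho r)%:C *: (v *m map_mx toC (Om r)).
    by rewrite -mulmxA -map_mxM Eave_Omega map_mxZ scalemxAr.
  rewrite vE -scalemxAl => /eqP; rewrite -subr_eq0 -scalerBl scaler_eq0 subr_eq0 na.
  by move/eqP.
rewrite raddf_sum mulmx_sumr big1 // => r _ /=.
by rewrite map_mxZ -Omega_EclK // map_mxM -scalemxAr mulmxA vO mul0mx scaler0.
Qed.

Lemma sum_card_clusters : (0 < #|C|)%N ->
  #|C|%:R - 1 = \sum_(r < l) (#|Cl r|%:R - 1) :> R.
Proof.
(* With all weights 1, E is the plain sum of the E_r, whose trace is computed in two ways. *)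
move=> C0; pose E := Eave M Cl (fun _ => 1).
have EE : E *m E = E.
  rewrite {2 3}/E mulmx_sumr; apply: eq_bigr => r _.
  by rewrite !scale1r -Omega_EclK // mulmxA Eave_Omega scale1r.
have EPi : E *m Pi = Pi.
  (* The columns of E Pi - Pi have zero sum and are killed by E, so they vanish. *)
  apply/eqP; rewrite -subr_eq0; apply/eqP/matrixP => i j; rewrite [RHS]mxE.
  set D := _ - _; suff /colP/(_ i) : col j D = 0 by rewrite !mxE.
  apply: (Eave_inj Msym Mpd clC cl0 conn (rho := fun _ => 1)) => //.
    by rewrite colE mulmxA mulmxBr sum_zero_Eave // indic_super_Omega ?subrr ?mul0mx.
  by rewrite colE mulmxA mulmxBr mulmxA EE subrr mul0mx.
have <- : \tr E = #|C|%:R - 1.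
  by rewrite -(mxtrace_Omega R (subxx C)) // -EPi mxtrace_mulC Omega_Eave.
by rewrite mxtrace_Eave; apply: eq_bigr => r _; rewrite mul1r.
Qed.

End Hyper.

(** * Optimal rate for edge-disjoint clusters in a tree *)

Theorem mainTheorem6 (R : rcfType) (n p : nat) (src tgt : 'I_p -> 'I_n)
    (o : 'I_n) (z : 'I_p -> R[i]) (X : 'M[R[i]]_n)
    (C : {set 'I_n}) (l : nat) (Cl : 'I_l -> {set 'I_n}) (rho : 'I_l -> R)
    (Gtree : is_tree src tgt)
    (z_re_gt0 : forall e, 0 < complex.Re (z e))
    (Xgreen : is_green src tgt z o X)
    (Cl_clusters : clustering C Cl)
    (Cl_card : forall r, (2 <= #|Cl r|)%N)
    (Hconn : hyper_connected C Cl)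
    (Cl_disj : edge_disjoint src tgt Cl)
    (rho_prob : pos_prob rho) :
  let M := re_submx C X in
  let m := #|C| in
  (* (a) *)
  [/\ forall (r : 'I_l) (x : 'cV[R]_#|C|),
        (exists y : 'cV[R]_#|C|, x = Omega R C (Cl r) *m y) ->
        Eave M Cl rho *m x = rho r *: x,
      forall lambda : R[i],
        ceigenvalue (Eave M Cl rho) lambda <->
        lambda = 0 \/ exists r : 'I_l, lambda = (rho r)%:C
    & is_beta (Fave M Cl rho) (1 - min_prob rho)] /\
  (* (b) *)
  [/\ pos_prob (@uniform_prob R l),
      is_beta (Fave M Cl (@uniform_prob R l)) (1 - l%:R^-1)
    & forall rho' : 'I_l -> R, pos_prob rho' ->
        exists2 b, is_beta (Fave M Cl rho') b & 1 - l%:R^-1 <= b] /\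
  (* (c) *)
  m%:Z - 1 = \sum_(r < l) #|Cl r|%:Z - l%:Z /\
  forall c : nat, (forall r, #|Cl r| = c) ->
    [/\ l%:Z * c%:Z = m%:Z + l%:Z - 1,
        1 - l%:R^-1 = 1 - (c%:R - 1) / (m%:R - 1) :> R,
        is_beta (Fave M Cl (@uniform_prob R l))
                (1 - (c%:R - 1) / (m%:R - 1))
      & forall (l' : nat) (Cl' : 'I_l' -> {set 'I_n}) (rho' : 'I_l' -> R),
          clustering C Cl' -> hyper_connected C Cl' ->
          (forall r, #|Cl' r| = c) -> pos_prob rho' ->
          exists2 b, is_beta (Fave M Cl' rho') b &
                     1 - (c%:R - 1) / (m%:R - 1) <= b].
Proof.
move=> M m; case: Gtree => Gconn Gacyc.
have Msym : M^T = M := re_submx_sym C Xgreen.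
have Mpd : sum_zero_pd M := re_submx_pd Gacyc z_re_gt0 Xgreen.
have cl0 r : (0 < #|Cl r|)%N := ltnW (Cl_card r).
have clS := cluster_sub Cl_clusters.
have disj r s : r != s -> Omega R C (Cl r) *m M *m Omega R C (Cl s) = 0.
  by move=> rs; apply: (re_submx_disj Gacyc z_re_gt0 Xgreen) => //; apply: Cl_disj.
(* Total mass 1 provides a cluster, whence l > 0 and, by its two nodes, m > 1. *)
have [r0 _ _] := min_probP rho_prob.
have l0 : (0 < l)%N := leq_ltn_trans (leq0n r0) (ltn_ord r0).
have C1 : (1 < #|C|)%N := leq_trans (Cl_card r0) (subset_leq_card (clS r0)).
have betaE rho' : pos_prob rho' -> is_beta (Fave M Cl rho') (1 - min_prob rho').
  move=> prho'; rewrite FaveE; last by case: prho'.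
  by apply: is_beta_compl => // a; apply: ceigenvalue_Eave => //; apply: ltnW.
have uprob := @uniform_pos_prob R l l0.
have beta_unif : is_beta (Fave M Cl (@uniform_prob R l)) (1 - l%:R^-1).
  by rewrite -min_uniform_prob //; apply: betaE.
have cardE : m%:Z - 1 = \sum_(r < l) #|Cl r|%:Z - l%:Z.
  apply: (@intr_inj R); rewrite !rmorphB /= rmorph_sum /=.
  rewrite (sum_card_clusters Msym Mpd Cl_clusters) //; last exact: ltnW.
  by rewrite sumrB sumr_const card_ord.
split; [split|split; [split|split]].
- by move=> r _ [y ->]; rewrite mulmxA Eave_Omega // scalemxAl.
- by move=> a; apply: ceigenvalue_Eave => //; apply: ltnW.
- exact: betaE.
- exact: uprob.
- exact: beta_unif.
- move=> rho' prho'; exists (1 - min_prob rho'); first exact: betaE.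
  by rewrite lerB // min_prob_le.
- exact: cardE.
move=> c clc.
have lc : l%:Z * c%:Z = m%:Z + l%:Z - 1.
  rewrite addrAC cardE subrK; under eq_bigr => r _ do rewrite clc.
  by rewrite sumr_const card_ord -mulr_natl natz.
have c1 : (1 < c)%N by rewrite -(clc r0).
have lR : 1 - l%:R^-1 = 1 - (c%:R - 1) / (m%:R - 1) :> R.
  (* Dividing by the nonzero c - 1 then gives (c - 1) / (m - 1) = 1 / l. *)
  have : (l%:R * (c%:R - 1) = m%:R - 1 :> R).
    move/(congr1 (fun k => k%:~R : R)): lc.
    rewrite rmorphM rmorphB rmorphD /= => lcR.
    by rewrite mulrBr mulr1 lcR addrAC addrK.
  move=> <-; rewrite invfM mulrCA divff ?mulr1 //.
  by rewrite subr_eq0 pnatr_eq1 gtn_eqF.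
split; [exact: lc | exact: lR | by rewrite -lR |].
move=> l' Cl' rho' clC' conn' clc' prho'.
(* The bound c > 1, inherited from the given clusters, makes the competing ones nonempty. *)
by apply: beta_lower_bound => // r; rewrite clc' ltnW.
Qed.
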